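(* Let $F=\alpha+\beta$ be a positive definite Randers metric on a manifold $M$, let $W\in\mathcal{X}(M)$ be a vector field with $F(-W)<1$ on $M$, and let $\widetilde F=\widetilde\alpha+\widetilde\beta$ be the Randers metric with general navigation data $(F,W)$. Then the Legendre dual $\widetilde{\mathcal{K}}:T^*M\to\mathbb{R}$ of $\widetilde F$ is $$\widetilde{\mathcal{K}}=\mathcal{K}+W^*,$$ where $\mathcal{K}$ is the Legendre dual of $F$ and $W^*(x,p)=W^i(x)p_i$.
   Context: A Randers metric is a Finsler metric $F=\alpha+\beta$ with $\alpha=\sqrt{a_{ij}(x)y^iy^j}$ a Riemannian metric and $\beta=b_i(x)y^i$ a one-form; it is positive definite iff $\|b\|_\alpha<1$. $\widetilde F$ has general navigation data $(F,W)$ (is the solution of Zermelo's navigation problem for $(F,W)$) if its indicatrix $\{y\in T_xM:\widetilde F(x,y)=1\}$ is, for every $x\in M$, the rigid translate by $W(x)$ of the indicatrix $\{u\in T_xM:F(x,u)=1\}$ of $F$. The Legendre transformation $\mathcal{L}_F:TM\setminus 0\to T^*M\setminus 0$ of a Finsler metric $F$ sends $(x,y)$ to $(x,p)$ with $p(v)=\frac12\frac{d}{dt}F^2(x,y+tv)\big|_{t=0}$ for $v\in T_xM$. The Legendre dual of $F$ is the function $\mathcal{K}:T^*M\to\mathbb{R}$ determined by $\mathcal{K}(\mathcal{L}_F(x,y))=F(x,y)$ for $y\neq 0$ (and $\mathcal{K}(x,0)=0$). *)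

(* Defs.v *)
From HB Require Import structures.
From mathcomp Require Import all_boot all_order all_algebra.
From mathcomp Require Import all_classical all_reals all_analysis.
Set Implicit Arguments.
Unset Strict Implicit.
Unset Printing Implicit Defensive.
Import Order.TTheory GRing.Theory Num.Theory.
Import numFieldNormedType.Exports.
Local Open Scope classical_set_scope.
Local Open Scope ring_scope.

(** Smooth functions on open sets of R^n *)

Fixpoint iter_derive (R : realType) (U V : normedModType R) (f : U -> V)
    (s : seq U) : U -> V :=
  if s is v :: s' then fun u => 'D_v (iter_derive f s') u else f.

(* C^oo: every iterated directional derivative exists and is (Frechet)
   differentiable at every point of [D]; [D] is open in all uses. *)
Definition smooth_on (R : realType) (U V : normedModType R) (D : set U)
    (f : U -> V) : Prop :=
  forall s u, D u -> differentiable (iter_derive f s) u.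

(** Smooth manifolds *)

(* Charts are total functions; only their values on [chart_dom] and
   [chart_img] matter. *)
Record chart (R : realType) (n : nat) (T : topologicalType) := Chart {
  chart_dom : set T;
  chart_map : T -> 'rV[R]_n;
  chart_inv : 'rV[R]_n -> T;
  chart_img := chart_map @` chart_dom;
  chart_dom_open : open chart_dom;
  chart_img_open : open chart_img;
  chart_mapK : forall x, chart_dom x -> chart_inv (chart_map x) = x;
  chart_map_cont : forall x, chart_dom x -> {for x, continuous chart_map};
  chart_inv_cont : forall u, chart_img u -> {for u, continuous chart_inv}
}.

Definition transition (R : realType) (n : nat) (T : topologicalType)
    (c d : chart R n T) : 'rV[R]_n -> 'rV[R]_n :=
  chart_map d \o chart_inv c.

(* [atlas_index] need not index a maximal atlas: smoothness of the objects
   below does not depend on the atlas chosen in a smooth structure. *)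
Record manifold (R : realType) (n : nat) := Manifold {
  mcarrier :> topologicalType;
  mhausdorff : hausdorff_space mcarrier;
  mcountable : @second_countable mcarrier;
  atlas_index : Type;
  atlas : atlas_index -> chart R n mcarrier;
  atlas_cover : forall x, exists i, chart_dom (atlas i) x;
  atlas_compat : forall i j,
    smooth_on (chart_map (atlas i) @`
                 (chart_dom (atlas i) `&` chart_dom (atlas j)))
              (transition (atlas i) (atlas j))
}.

(** Tangent and cotangent spaces *)

(* A tangent vector at x is the family of its coordinate representations in
   the charts around x, related to each other by the differentials of the
   transition maps (and 0 by convention in the charts not containing x). *)
Definition tangent_coherent (R : realType) (n : nat) (M : manifold R n) (x : M)
    (v : atlas_index M -> 'rV[R]_n) : Prop :=
  (forall i, ~ chart_dom (atlas i) x -> v i = 0) /\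
  (forall i j, chart_dom (atlas i) x -> chart_dom (atlas j) x ->
     v j = 'd (transition (atlas i) (atlas j)) (chart_map (atlas i) x) (v i)).

Definition tangent_pred (R : realType) (n : nat) (M : manifold R n) (x : M) :
    {pred (atlas_index M -> 'rV[R]_n)} :=
  fun v => `[< tangent_coherent x v >].

Lemma tangent_pred_closed (R : realType) (n : nat) (M : manifold R n) (x : M) :
  GRing.subsemimod_closed (tangent_pred x).
Proof.
split; first split.
- by apply/asboolP; split => [//|i j _ _]; exact/esym/linear0.
- move=> v w /asboolP[v0 vE] /asboolP[w0 wE]; apply/asboolP; split.
    by move=> i xi; rewrite [LHS]/GRing.add/= v0// w0// addr0.
  move=> i j xi xj.
  by rewrite [LHS]/GRing.add/= (vE i j)// (wE i j)//; exact/esym/linearD.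
- move=> a v /asboolP[v0 vE]; apply/asboolP; split.
    by move=> i xi; rewrite [LHS]/GRing.scale/= v0// scaler0.
  move=> i j xi xj.
  by rewrite [LHS]/GRing.scale/= (vE i j)//; exact/esym/linearZ.
Qed.

HB.instance Definition _ (R : realType) (n : nat) (M : manifold R n) (x : M) :=
  GRing.isSubSemiModClosed.Build R (atlas_index M -> 'rV[R]_n)
    (tangent_pred x) (tangent_pred_closed x).

Record tangent (R : realType) (n : nat) (M : manifold R n) (x : M) := Tangent {
  tcoord :> atlas_index M -> 'rV[R]_n;
  _ : tcoord \in tangent_pred x
}.

HB.instance Definition _ (R : realType) (n : nat) (M : manifold R n) (x : M) :=
  [isSub for @tcoord R n M x].
HB.instance Definition _ (R : realType) (n : nat) (M : manifold R n) (x : M) :=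
  [Choice of tangent x by <:].
HB.instance Definition _ (R : realType) (n : nat) (M : manifold R n) (x : M) :=
  [SubChoice_isSubLmodule of tangent x by <:].

Definition cotangent (R : realType) (n : nat) (M : manifold R n) (x : M) :=
  {linear tangent x -> R^o}.

(** Smooth tensor fields *)

Definition smooth_vector_field (R : realType) (n : nat) (M : manifold R n)
    (W : forall x : M, tangent x) : Prop :=
  forall i, smooth_on (chart_img (atlas i))
              (fun u => W (chart_inv (atlas i) u) i).

(* In the chart i, beta = b_k(x) y^k with smooth b_k. *)
Definition smooth_one_form (R : realType) (n : nat) (M : manifold R n)
    (beta : forall x : M, cotangent x) : Prop :=
  forall i : atlas_index M, exists b : 'rV[R]_n -> 'rV[R]_n,
    (forall k, smooth_on (chart_img (atlas i)) (fun u => b u 0 k : R^o)) /\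
    (forall x, chart_dom (atlas i) x -> forall y : tangent x,
       beta x y = \sum_k b (chart_map (atlas i) x) 0 k * y i 0 k).

(* In the chart i, g(y, z) = a_kl(x) y^k z^l with smooth a_kl; in particular
   g is bilinear. *)
Definition riemannian_metric (R : realType) (n : nat) (M : manifold R n)
    (g : forall x : M, tangent x -> tangent x -> R) : Prop :=
  [/\ forall x (y z : tangent x), g x y z = g x z y,
      forall x (y : tangent x), y != 0 -> 0 < g x y y
    & forall i : atlas_index M, exists a : 'rV[R]_n -> 'M[R]_n,
        (forall k l, smooth_on (chart_img (atlas i))
                               (fun u => a u k l : R^o)) /\
        (forall x, chart_dom (atlas i) x -> forall y z : tangent x,
           g x y z = \sum_k \sum_l
             a (chart_map (atlas i) x) k l * y i 0 k * z i 0 l)].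

(** Randers metrics *)

Definition riemannian_norm (R : realType) (n : nat) (M : manifold R n)
    (g : forall x : M, tangent x -> tangent x -> R) (x : M) (y : tangent x) : R :=
  Num.sqrt (g x y y).

(* Dual norm of a covector, with values in the extended reals so that the
   supremum is never a default value. *)
Definition covector_norm (R : realType) (n : nat) (M : manifold R n)
    (g : forall x : M, tangent x -> tangent x -> R) (x : M) (p : cotangent x) :
    \bar R :=
  ereal_sup [set (`|p y : R|)%:E | y in [set y | riemannian_norm g y <= 1]].

Definition randers_metric (R : realType) (n : nat) (M : manifold R n)
    (F : forall x : M, tangent x -> R)
    (g : forall x : M, tangent x -> tangent x -> R)
    (beta : forall x : M, cotangent x) : Prop :=
  [/\ riemannian_metric g, smooth_one_form beta
    & forall x (y : tangent x), F x y = riemannian_norm g y + beta x y].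

Definition randers_positive_definite (R : realType) (n : nat) (M : manifold R n)
    (g : forall x : M, tangent x -> tangent x -> R)
    (beta : forall x : M, cotangent x) : Prop :=
  forall x, (covector_norm g (beta x) < 1)%E.

(** Navigation data and Legendre duality *)

Definition indicatrix (R : realType) (n : nat) (M : manifold R n)
    (F : forall x : M, tangent x -> R) (x : M) : set (tangent x) :=
  [set y | F x y = 1].
Arguments indicatrix {R n M} F x.

Definition has_navigation_data (R : realType) (n : nat) (M : manifold R n)
    (Ft F : forall x : M, tangent x -> R) (W : forall x : M, tangent x) : Prop :=
  forall x, indicatrix Ft x = [set u + W x | u in indicatrix F x].

Definition legendre (R : realType) (n : nat) (M : manifold R n)
    (F : forall x : M, tangent x -> R) (x : M) (y v : tangent x) : R :=
  2^-1 * derive1 (fun t : R => F x (y + t *: v) ^+ 2) 0.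

(* [p] ranges over the covectors equal to [legendre F y], which avoids having
   to bundle [legendre F y] as a linear form. *)
Definition legendre_dual (R : realType) (n : nat) (M : manifold R n)
    (F : forall x : M, tangent x -> R)
    (K : forall x : M, cotangent x -> R) : Prop :=
  (forall x (y : tangent x) (p : cotangent x), y != 0 ->
     (forall v, p v = legendre F y v) -> K x p = F x y) /\
  (forall x (p : cotangent x), (forall v, p v = 0) -> K x p = 0).

Definition wstar (R : realType) (n : nat) (M : manifold R n)
    (W : forall x : M, tangent x) (x : M) (p : cotangent x) : R := p (W x).

(* Main.v *)
From HB Require Import structures.
Require Import Defs.
From mathcomp Require Import all_boot all_order all_algebra.
From mathcomp Require Import all_classical all_reals all_analysis.
From mathcomp Require Import ring lra.
Import Order.TTheory GRing.Theory Num.Theory.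
Import numFieldNormedType.Exports.
Local Open Scope classical_set_scope.
Local Open Scope ring_scope.

(* Fiberwise, write [F] and [G] for the two Randers norms and [E], [D] for their
   differentials. Since the indicatrix of [G] is that of [F] translated by [w],
   [G y] is the solution [s] of [F (y - s w) = s]. Differentiating this identity
   at [y], with [u = y - G(y) w], gives [E_u = (1 + E_u w) D_y], where
   [1 + E_u w > 0] because [E_u (- w) <= F (- w) < 1]. Hence [L_G y = L_F u'] for
   [u' = u / (1 + E_u w)], and [G y = F u' + (L_G y) w].
   Conversely the dual of [G] is determined by its values on the image of [L_G],
   which contains every nonzero covector [p]: if [q] and [z] represent [p] and
   the linear part of [G], a unit vector [e = m q - z] with [m > 0] satisfies
   [D_e = m p]. *)

(** * Inner products and Randers norms on a single vector space *)

Definition inner_product {R : realType} {V : lmodType R} (g : V -> V -> R) :=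
  [/\ forall a y z v, g (a *: y + z) v = a * g y v + g z v,
      forall y z, g y z = g z y
    & forall y, y != 0 -> 0 < g y y].

Definition inner_norm {R : realType} {V : lmodType R} (g : V -> V -> R) (y : V) : R :=
  Num.sqrt (g y y).

Definition randers {R : realType} {V : lmodType R} (g : V -> V -> R)
    (b : {linear V -> R^o}) (y : V) : R :=
  inner_norm g y + b y.

Definition randers_diff {R : realType} {V : lmodType R} (g : V -> V -> R)
    (b : {linear V -> R^o}) (y v : V) : R :=
  g y v / inner_norm g y + b v.

(** The formula of [legendre] with the base point removed, so that the argument can be carried out
    on one abstract vector space. *)
Definition fiber_legendre {R : realType} {V : lmodType R} (F : V -> R) (y v : V) : R :=
  2^-1 * derive1 (fun t : R => F (y + t *: v) ^+ 2) 0.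

Lemma innerDl {R : realType} {V : lmodType R} {g : V -> V -> R} :
  inner_product g -> forall y z v, g (y + z) v = g y v + g z v.
Proof. by move=> [gL _ _] y z v; rewrite -[y]scale1r gL mul1r scale1r. Qed.

Lemma inner0l {R : realType} {V : lmodType R} {g : V -> V -> R} :
  inner_product g -> forall v, g 0 v = 0.
Proof.
move=> gP v; have := innerDl gP 0 0 v; rewrite addr0 => /eqP.
by rewrite -subr_eq0 opprD addNKr oppr_eq0 => /eqP.
Qed.

Lemma innerZl {R : realType} {V : lmodType R} {g : V -> V -> R} :
  inner_product g -> forall a y v, g (a *: y) v = a * g y v.
Proof.
by move=> gP a y v; have [gL _ _] := gP; rewrite -[a *: y]addr0 gL (inner0l gP)// addr0.
Qed.

Lemma innerDr {R : realType} {V : lmodType R} {g : V -> V -> R} :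
  inner_product g -> forall y z v, g v (y + z) = g v y + g v z.
Proof.
move=> gP y z v; have [_ gC _] := gP.
by rewrite gC (innerDl gP)// (gC y) (gC z).
Qed.

Lemma innerZr {R : realType} {V : lmodType R} {g : V -> V -> R} :
  inner_product g -> forall a y v, g v (a *: y) = a * g v y.
Proof.
by move=> gP a y v; have [_ gC _] := gP; rewrite gC (innerZl gP)// (gC y).
Qed.

Lemma inner_suml {R : realType} {V : lmodType R} {g : V -> V -> R} :
  inner_product g -> forall k (e : 'I_k -> V) v,
  g (\sum_i e i) v = \sum_i g (e i) v.
Proof.
move=> gP k e v; apply: (big_ind2 (fun y a => g y v = a)) => //.
- exact: inner0l.
- by move=> y a z c <- <-; rewrite innerDl.
Qed.

Lemma inner_ge0 {R : realType} {V : lmodType R} {g : V -> V -> R} :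
  inner_product g -> forall y, 0 <= g y y.
Proof.
move=> gP y; have [->|y0] := eqVneq y 0; first by rewrite inner0l.
by have [_ _ /(_ _ y0)/ltW] := gP.
Qed.

Lemma inner_norm0 {R : realType} {V : lmodType R} {g : V -> V -> R} :
  inner_product g -> inner_norm g 0 = 0.
Proof. by move=> gP; rewrite /inner_norm (inner0l gP)// sqrtr0. Qed.

Lemma inner_norm_gt0 {R : realType} {V : lmodType R} {g : V -> V -> R} :
  inner_product g -> forall y, y != 0 -> 0 < inner_norm g y.
Proof. by move=> [_ _ g0] y y0; rewrite sqrtr_gt0 g0. Qed.

Lemma sqr_inner_norm {R : realType} {V : lmodType R} {g : V -> V -> R} :
  inner_product g -> forall y, inner_norm g y ^+ 2 = g y y.
Proof. by move=> gP y; rewrite sqr_sqrtr// inner_ge0. Qed.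

Lemma inner_normZ {R : realType} {V : lmodType R} {g : V -> V -> R} :
  inner_product g -> forall a y, 0 <= a ->
  inner_norm g (a *: y) = a * inner_norm g y.
Proof.
move=> gP a y a0; rewrite /inner_norm (innerZl gP)// (innerZr gP)// mulrA -expr2.
by rewrite sqrtrM ?sqr_ge0// sqrtr_sqr ger0_norm.
Qed.

Lemma inner_cauchy_schwarz {R : realType} {V : lmodType R} {g : V -> V -> R} :
  inner_product g -> forall y z, g y z <= inner_norm g y * inner_norm g z.
Proof.
move=> gP y z; have [_ gC _] := gP.
have [->|y0] := eqVneq y 0; first by rewrite (inner0l gP) (inner_norm0 gP) mul0r.
have [->|z0] := eqVneq z 0; first by rewrite gC (inner0l gP) (inner_norm0 gP) mulr0.
have s0 := inner_norm_gt0 gP y y0; have t0 := inner_norm_gt0 gP z z0.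
(* With [s], [t] the norms of [y], [z] and [c = g y z], the square of [t *: y - s *: z] expands to
   [2 * s * t * (s * t - c)]. *)
have := inner_ge0 gP (inner_norm g z *: y + (- inner_norm g y) *: z).
rewrite !(innerDl gP, innerDr gP, innerZl gP, innerZr gP) (gC z y).
rewrite -!(sqr_inner_norm gP).
move: (inner_norm g y) (inner_norm g z) (g y z) s0 t0 => s t c s0 t0 h.
have : 0 <= (s * t) * (s * t - c) by lra.
by rewrite pmulr_rge0 ?mulr_gt0// subr_ge0.
Qed.

Lemma inner_normD {R : realType} {V : lmodType R} {g : V -> V -> R} :
  inner_product g ->
  forall y z, inner_norm g (y + z) <= inner_norm g y + inner_norm g z.
Proof.
move=> gP y z; have [_ gC _] := gP.
rewrite -(@ler_pXn2r _ 2)// ?nnegrE ?addr_ge0 ?sqrtr_ge0//.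
rewrite sqrrD !(sqr_inner_norm gP) (innerDl gP) !(innerDr gP) (gC z y).
have := inner_cauchy_schwarz gP y z; lra.
Qed.

Lemma randersD {R : realType} {V : lmodType R} {g : V -> V -> R} :
  inner_product g -> forall b y z,
  randers g b (y + z) <= randers g b y + randers g b z.
Proof.
by move=> gP b y z; rewrite /randers linearD addrACA lerD2r inner_normD.
Qed.

Lemma randersZ {R : realType} {V : lmodType R} {g : V -> V -> R} :
  inner_product g -> forall b a y, 0 <= a ->
  randers g b (a *: y) = a * randers g b y.
Proof.
by move=> gP b a y a0; rewrite /randers (inner_normZ gP)// linearZ mulrDr.
Qed.

Lemma randers0 {R : realType} {V : lmodType R} {g : V -> V -> R} :
  inner_product g -> forall b, randers g b 0 = 0.
Proof. by move=> gP b; rewrite /randers (inner_norm0 gP)// linear0 addr0. Qed.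

(** The fundamental inequality of Finsler geometry: the linear parts agree, and Cauchy-Schwarz
    compares the Riemannian parts. *)
Lemma randers_diff_le {R : realType} {V : lmodType R} {g : V -> V -> R} :
  inner_product g -> forall b y v, y != 0 ->
  randers_diff g b y v <= randers g b v.
Proof.
move=> gP b y v y0; rewrite lerD2r ler_pdivrMr ?(inner_norm_gt0 gP)//.
by rewrite mulrC inner_cauchy_schwarz.
Qed.

Lemma linear_formD {R : realType} {V : lmodType R} (b : {linear V -> R^o}) y z :
  b (y + z) = (b y : R) + (b z : R) :> R.
Proof. exact: linearD. Qed.

Lemma linear_formZ {R : realType} {V : lmodType R} (b : {linear V -> R^o}) a y :
  b (a *: y) = a * (b y : R) :> R.
Proof. exact: linearZ. Qed.

Lemma randers_diffZD {R : realType} {V : lmodType R} {g : V -> V -> R} :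
  inner_product g -> forall b y a v w,
  randers_diff g b y (v + a *: w) = randers_diff g b y v + a * randers_diff g b y w.
Proof.
move=> gP b y a v w; rewrite /randers_diff (innerDr gP)// (innerZr gP)// linearD linearZ/=.
by rewrite /GRing.scale/=; ring.
Qed.

Lemma randers_diffZ {R : realType} {V : lmodType R} {g : V -> V -> R} :
  inner_product g -> forall b y a v, 0 < a ->
  randers_diff g b (a *: y) v = randers_diff g b y v.
Proof.
move=> gP b y a v a0; rewrite /randers_diff (innerZl gP)// inner_normZ ?ltW//.
by rewrite -mulf_div divff ?gt_eqF// mul1r.
Qed.

(** * Derivatives and continuity along curves *)

(** The coefficient of [w] varies with [t] because the navigation identity involves [y - G(y) w]. As
    [V] carries no topology, everything is reduced to real functions of [t]: the radicand [q] and
    the linear part [l]. The square root is differentiable since [q 0 > 0]. *)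
Lemma is_derive_randers {R : realType} {V : lmodType R} {g : V -> V -> R} :
  inner_product g -> forall b y v w (phi : R -> R) dphi,
  is_derive (0 : R) 1 phi dphi -> y + phi 0 *: w != 0 ->
  is_derive (0 : R) 1 (fun t => randers g b (y + t *: v + phi t *: w))
    (randers_diff g b (y + phi 0 *: w) (v + dphi *: w)).
Proof.
move=> gP b y v w phi dphi phiP y0; have [_ gC g_gt0] := gP.
pose q (t : R) := g y y + 2 * g y v * t + g v v * t ^+ 2 +
  phi t * (2 * g y w + 2 * g v w * t + g w w * phi t).
pose l (t : R) := (b y : R) + (b v : R) * t + (b w : R) * phi t.
have qE t : g (y + t *: v + phi t *: w) (y + t *: v + phi t *: w) = q t.
  rewrite !(innerDl gP, innerDr gP, innerZl gP, innerZr gP).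
  by rewrite (gC v y) (gC w y) (gC w v) /q; ring.
have lE t : b (y + t *: v + phi t *: w) = l t.
  by rewrite !(linear_formD, linear_formZ) /l; ring.
have fE : (fun t => randers g b (y + t *: v + phi t *: w)) =
    (fun t => Num.sqrt (q t) + l t).
  by apply/funext => t; rewrite /randers /inner_norm qE lE.
have q0 : q 0 = g (y + phi 0 *: w) (y + phi 0 *: w).
  by rewrite -qE scale0r addr0.
have q0_gt0 : 0 < q 0 by rewrite q0 g_gt0.
have dq : is_derive (0 : R) 1 q (2 * g (y + phi 0 *: w) (v + dphi *: w)).
  apply: is_derive_eq.
  rewrite !(innerDl gP, innerDr gP, innerZl gP, innerZr gP) (gC w v).
  rewrite /GRing.scale/=; ring.
have dl : is_derive (0 : R) 1 l (b (v + dphi *: w)).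
  apply: is_derive_eq.
  by rewrite linear_formD linear_formZ /GRing.scale/=; ring.
have ds := is_derive1_comp (is_derive1_sqrt q0_gt0) dq.
rewrite fE (_ : randers_diff _ _ _ _ =
  (2 * Num.sqrt (q 0))^-1 * (2 * g (y + phi 0 *: w) (v + dphi *: w)) +
  (b (v + dphi *: w) : R)); first exact: (is_deriveD ds dl).
rewrite /randers_diff /inner_norm -q0; congr (_ + _).
have : Num.sqrt (q 0) != 0 by rewrite gt_eqF// sqrtr_gt0.
move: (Num.sqrt _) => s s0; by field.
Qed.

Lemma is_derive_randers_line {R : realType} {V : lmodType R} {g : V -> V -> R} :
  inner_product g -> forall b y v, y != 0 ->
  is_derive (0 : R) 1 (fun t => randers g b (y + t *: v)) (randers_diff g b y v).
Proof.
move=> gP b y v y0; have y0' : y + (0 : R) *: 0 != 0 by rewrite scaler0 addr0.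
have := is_derive_randers gP b y v 0 (fun=> 0) 0 (is_derive_cst _ _ _) y0'.
have -> : (fun t => randers g b (y + t *: v + (fun=> 0) t *: 0)) =
    (fun t => randers g b (y + t *: v)).
  by apply/funext => t; rewrite scaler0 addr0.
by rewrite !scaler0 !addr0.
Qed.

Lemma fiber_legendre_randers {R : realType} {V : lmodType R} {g : V -> V -> R} :
  inner_product g -> forall b y v, y != 0 ->
  fiber_legendre (randers g b) y v = randers g b y * randers_diff g b y v.
Proof.
move=> gP b y v y0; have d := is_derive_randers_line gP b y v y0.
have := is_deriveX 2 d => /(@derive_val _ _ _ _ _ _ _) dE.
rewrite /fiber_legendre derive1E [X in _ * X]dE scale0r addr0 /GRing.scale/=.
by field.
Qed.

Lemma continuous_randers_line {R : realType} {V : lmodType R} {g : V -> V -> R} :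
  inner_product g -> forall b y v,
  continuous (fun t : R => randers g b (t *: y + v)).
Proof.
move=> gP b y v; have [_ gC _] := gP.
pose q (t : R) := g v v + 2 * g y v * t + g y y * (t * t).
pose l (t : R) := (b v : R) + (b y : R) * t.
have -> : (fun t => randers g b (t *: y + v)) = (fun t => Num.sqrt (q t) + l t).
  apply/funext => t; rewrite /randers /inner_norm /q /l !(linear_formD, linear_formZ).
  rewrite !(innerDl gP, innerDr gP, innerZl gP, innerZr gP) (gC v y).
  by congr (Num.sqrt _ + _); ring.
move=> t; apply: cvgD.
  apply: (@continuous_comp _ _ _ q Num.sqrt); last exact: sqrt_continuous.
  apply: cvgD; first apply: cvgD; first exact: cvg_cst.
    by apply: cvgM; [exact: cvg_cst|exact: cvg_id].
  apply: cvgM; [exact: cvg_cst|apply: cvgM; exact: cvg_id].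
apply: cvgD; first exact: cvg_cst.
by apply: cvgM; [exact: cvg_cst|exact: cvg_id].
Qed.

(** * Zermelo navigation on one fiber *)

(** Positivity of the translated norm comes from the intermediate value theorem: since [- w] lies
    inside the indicatrix of the first norm, the ray through [y] must cross the translated
    indicatrix at some [t > 0], and homogeneity does the rest. *)
Lemma navigation_gt0 {R : realType} {V : lmodType R} {g h : V -> V -> R}
    {b c : {linear V -> R^o}} {w : V} :
  inner_product g -> inner_product h ->
  (forall y : V, y != 0 -> 0 < randers g b y) ->
  randers g b (- w) < 1 ->
  (forall y, randers g b (y - w) = 1 -> randers h c y = 1) ->
  forall y, y != 0 -> 0 < randers h c y.
Proof.
move=> gP hP F0 Fw nav y y0.
have Fw0 : 0 <= randers g b w.
  by have [->|/F0/ltW//] := eqVneq w 0; rewrite (randers0 gP).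
(* [T] solves [T * F y = 1 + F w], so the triangle inequality forces [F (T *: y - w) >= 1]. *)
pose T := (1 + randers g b w) / randers g b y.
have T0 : 0 <= T by exact: divr_ge0 (addr_ge0 ler01 Fw0) (ltW (F0 _ y0)).
have FT : 1 <= randers g b (T *: y - w).
  have := randersD gP b (T *: y - w) w.
  rewrite subrK (randersZ gP)// divfK ?gt_eqF ?F0//.
  by rewrite lerD2r.
have [||t tT Ft] := @IVT _ (fun t : R => randers g b (t *: y - w)) 0 T 1 T0.
- exact/continuous_subspaceT/continuous_randers_line.
- by rewrite scale0r add0r ge_min le_max (ltW Fw) FT orbT.
(* At [t = 0] the value would be [F (- w) < 1], not 1. *)
have t0 : 0 < t.
  move: tT; rewrite in_itv/= => /andP[+ _]; rewrite le_eqVlt => /predU1P[t0|//].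
  by move: Fw; rewrite -Ft -t0 scale0r add0r ltxx.
have := nav _ Ft; rewrite (randersZ hP) ?(ltW t0)// => tG.
by rewrite -(pmulr_rgt0 _ t0) tG.
Qed.

(** Scale [y] to the translated indicatrix, move back by [w], and undo the scaling by
    homogeneity. *)
Lemma navigation_implicit {R : realType} {V : lmodType R} {g h : V -> V -> R}
    {b c : {linear V -> R^o}} {w : V} :
  inner_product g -> inner_product h ->
  (forall y : V, y != 0 -> 0 < randers h c y) ->
  (forall y, randers h c y = 1 -> randers g b (y - w) = 1) ->
  forall y, randers g b (y - randers h c y *: w) = randers h c y.
Proof.
move=> gP hP G0 nav y; have [->|y0] := eqVneq y 0.
  by rewrite (randers0 hP) scale0r subr0 (randers0 gP).
have s0 := G0 _ y0; set s := randers h c y.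
have -> : y - s *: w = s *: (s^-1 *: y - w).
  by rewrite scalerBr scalerA divff ?gt_eqF// scale1r.
rewrite (randersZ gP) ?ltW// nav ?mulr1//.
by rewrite (randersZ hP) ?invr_ge0 ?ltW// mulVf// gt_eqF.
Qed.

Lemma navigation_diff {R : realType} {V : lmodType R} {g h : V -> V -> R}
    {b c : {linear V -> R^o}} {w : V} :
  inner_product g -> inner_product h ->
  (forall y, randers g b (y - randers h c y *: w) = randers h c y) ->
  forall y v, y != 0 -> y - randers h c y *: w != 0 ->
  randers_diff g b (y - randers h c y *: w) v =
  (1 + randers_diff g b (y - randers h c y *: w) w) * randers_diff h c y v.
Proof.
move=> gP hP nav y v y0 u0.
have := is_derive_randers_line hP c y v y0.
set G := fun t => _; set D := randers_diff h c y v => dG.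
have dN : is_derive (0 : R) 1 (fun t => - G t) (- D) by exact: is_deriveN.
have GE : G 0 = randers h c y by rewrite /G scale0r addr0.
have := is_derive_randers gP b y v w _ _ dN.
rewrite GE scaleNr => /(_ u0).
(* By the implicit identity the composed curve is [G] itself, so its chain-rule derivative equals
   [D]; this reads [E_u v - D * E_u w = D]. *)
rewrite (_ : (fun t => randers g b (y + t *: v + (- G t) *: w)) = G); last first.
  by apply/funext => t; rewrite scaleNr nav.
move=> dG'; have /esym := @derive_val _ _ _ _ _ _ _ dG'.
rewrite (@derive_val _ _ _ _ _ _ _ dG) (randers_diffZD gP) => E.
lra.
Qed.

Lemma navigation_legendre {R : realType} {V : lmodType R} {g h : V -> V -> R}
    {b c : {linear V -> R^o}} {w : V} :
  inner_product g -> inner_product h ->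
  (forall y : V, y != 0 -> 0 < randers g b y) ->
  randers g b (- w) < 1 ->
  (forall y, randers h c y = 1 <-> randers g b (y - w) = 1) ->
  forall y, y != 0 -> exists u, [/\ u != 0,
    forall v, fiber_legendre (randers g b) u v = fiber_legendre (randers h c) y v &
    randers h c y = randers g b u + fiber_legendre (randers h c) y w].
Proof.
move=> gP hP F0 Fw nav y y0.
have G0 : forall z, z != 0 -> 0 < randers h c z.
  by apply: (navigation_gt0 gP hP F0 Fw) => z /nav.
have nav' : forall z, randers g b (z - randers h c z *: w) = randers h c z.
  by apply: (navigation_implicit gP hP G0) => z /nav.
have := navigation_diff gP hP nav' y _ y0; have := nav' y.
set G := randers h c y; set u := y - G *: w => Fu dG.
have u0 : u != 0.
  by apply: contraTneq (G0 _ y0) => u0; rewrite -/G -Fu u0 (randers0 gP) ltxx.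
have k0 : 0 < 1 + randers_diff g b u w.
  have Nw : randers_diff g b u (- w) = - randers_diff g b u w.
    by rewrite /randers_diff -scaleN1r (innerZr gP) linear_formZ; ring.
  by have := randers_diff_le gP b u (- w) u0; rewrite Nw; lra.
have {}dG v := dG v u0.
set k := 1 + _ in k0 dG.
(* Rescaling keeps the differential [E_u = k D_y] and divides the norm by [k], so the two Legendre
   images agree: [(G / k) * (k D_y) = G * D_y]. *)
exists (k^-1 *: u); have kV0 : 0 < k^-1 by rewrite invr_gt0.
have ku0 : k^-1 *: u != 0 by rewrite scaler_eq0 negb_or gt_eqF.
split => // [v|].
  rewrite !fiber_legendre_randers// (randers_diffZ gP)// (randersZ gP) ?ltW//.
  by rewrite Fu dG -/G mulrACA mulrA mulrAC mulVf ?mul1r ?gt_eqF// mulrC.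
(* The relation at [w] gives [k - 1 = k * D_y w], whence [G / k + G * D_y w = G]. *)
rewrite fiber_legendre_randers// (randersZ gP) ?ltW// Fu -/G.
have E : randers_diff g b u w = k - 1 by rewrite /k addrC addKr.
have := dG w; rewrite E => /(congr1 (fun z => G * k^-1 * z)) H.
have {}H : G * randers_diff h c y w = G * k^-1 * (k - 1).
  by rewrite H; field; rewrite gt_eqF.
by rewrite H; field; rewrite gt_eqF.
Qed.

(** * Riesz representation and surjectivity of the Legendre map *)

(** The injection [f] encodes finite dimension. A relation between the rows [f (e i)] pulls back to
    one between the [e i], and pairing with [e j] kills its [j]-th coefficient. *)
Lemma orthonormal_card {R : realType} {V : lmodType R} {g : V -> V -> R} {n : nat}
    {f : {linear V -> 'rV[R]_n}} {k : nat} {e : 'I_k -> V} :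
  inner_product g -> injective f ->
  (forall i j, g (e i) (e j) = (i == j)%:R) -> (k <= n)%N.
Proof.
move=> gP f_inj eP; pose A := \matrix_(i < k) f (e i).
suff /eqP <- : row_free A by exact: rank_leq_col.
apply: inj_row_free => v vA; apply/rowP => j; rewrite mxE.
have : \sum_i v 0 i *: e i = 0.
  apply: f_inj; rewrite linear0 -vA mulmx_sum_row linear_sum.
  by apply: eq_bigr => i _; rewrite linearZ rowK.
move/(congr1 (g^~ (e j))); rewrite (inner0l gP) (inner_suml gP) (bigD1 j)//=.
rewrite (innerZl gP) eP eqxx mulr1 big1 ?addr0// => i ij.
by rewrite (innerZl gP) eP (negbTE ij) mulr0.
Qed.

(* A maximal orthonormal family [e] spans [V], so [\sum_i p (e i) *: e i]
   represents [p]. *)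
Lemma inner_riesz {R : realType} {V : lmodType R} {g : V -> V -> R} {n : nat}
    {f : {linear V -> 'rV[R]_n}} (p : {linear V -> R^o}) :
  inner_product g -> injective f -> exists z, forall v, p v = g z v.
Proof.
move=> gP f_inj; have [_ gC g_gt0] := gP.
pose P k := `[< exists e : 'I_k -> V, forall i j, g (e i) (e j) = (i == j)%:R >].
have P0 : exists k, P k by exists 0%N; apply/asboolP; exists (fun=> 0) => -[].
have Pn k : P k -> (k <= n)%N by move=> /asboolP[e] /(orthonormal_card gP f_inj).
case: (ex_maxnP P0 Pn) => k /asboolP[e eP] k_max.
exists (\sum_i (p (e i) : R) *: e i) => v.
have ge (a : 'I_k -> R) j : g (\sum_i a i *: e i) (e j) = a j.
  rewrite (inner_suml gP) (bigD1 j)//= (innerZl gP) eP eqxx mulr1 big1 ?addr0//.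
  by move=> i ij; rewrite (innerZl gP) eP (negbTE ij) mulr0.
pose w := v - \sum_i g v (e i) *: e i.
have we j : g w (e j) = 0.
  by rewrite (innerDl gP) -scaleN1r (innerZl gP) ge mulN1r subrr.
suff /eqP : w = 0.
  rewrite subr_eq0 => /eqP vE; rewrite (inner_suml gP) vE linear_sum.
  apply: eq_bigr => i _; rewrite -vE (innerZl gP) linearZ/= (gC _ v).
  by rewrite mulrC.
(* A nonzero residual [w], once normalised, would extend the family [e] to [k.+1] vectors, against
   maximality. *)
apply: contrapT => /eqP w0; have s0 := inner_norm_gt0 gP w w0.
suff /k_max : P k.+1 by rewrite ltnn.
apply/asboolP; pose u := (inner_norm g w)^-1 *: w.
have ue j : g u (e j) = 0 by rewrite (innerZl gP) we mulr0.
exists (fun i => if unlift ord_max i is Some j then e j else u) => i j.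
case: unliftP => [i'|] ->; case: unliftP => [j'|] ->.
- by rewrite eP (inj_eq (@lift_inj _ _)).
- by rewrite gC ue eq_sym (negbTE (neq_lift _ _)).
- by rewrite ue (negbTE (neq_lift _ _)).
- rewrite eqxx (innerZl gP) (innerZr gP) -(sqr_inner_norm gP).
  by rewrite mulrA -expr2 -exprMn mulVf ?expr1n// gt_eqF.
Qed.

(** The roots have product [(C - 1) / A < 0], so the larger one is positive. *)
Lemma quadratic_pos_root {R : realType} (A B C : R) : 0 < A -> C < 1 ->
  exists2 m, 0 < m & A * m ^+ 2 - 2 * B * m + C = 1.
Proof.
move=> A0 C1; pose s := Num.sqrt (B ^+ 2 + A * (1 - C)).
have AC : 0 < A * (1 - C) by rewrite mulr_gt0// subr_gt0.
have ss : s ^+ 2 = B ^+ 2 + A * (1 - C).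
  by rewrite sqr_sqrtr// addr_ge0 ?sqr_ge0 ?ltW.
have s0 : 0 <= s by rewrite sqrtr_ge0.
exists ((B + s) / A).
  rewrite divr_gt0// ltNge; apply/negP => Bs.
  have : s ^+ 2 <= B ^+ 2 by rewrite -(sqrrN B) lerXn2r ?nnegrE//; lra.
  lra.
rewrite (_ : _ + C = (s ^+ 2 - B ^+ 2 + A * C) / A); last by field; rewrite gt_eqF.
by rewrite ss; field; rewrite gt_eqF.
Qed.

Lemma fiber_legendre_surj {R : realType} {V : lmodType R} {g : V -> V -> R} {n : nat}
    {f : {linear V -> 'rV[R]_n}} {b : {linear V -> R^o}} (p : {linear V -> R^o}) :
  inner_product g -> injective f ->
  (forall y : V, y != 0 -> 0 < randers g b y) ->
  ~ (forall v, p v = 0) ->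
  exists2 y, y != 0 & forall v, p v = fiber_legendre (randers g b) y v.
Proof.
move=> gP f_inj F0 p0; have [_ gC g_gt0] := gP.
have [q qP] := inner_riesz p gP f_inj; have [z zP] := inner_riesz b gP f_inj.
have q0 : q != 0.
  by apply/eqP => q0; apply: p0 => v; rewrite qP q0 (inner0l gP).
have z1 : g z z < 1.
  have [->|z0] := eqVneq z 0; first by rewrite (inner0l gP).
  have s0 := inner_norm_gt0 gP z z0.
  (* At [- z] the Randers norm is [|z| - |z|^2]; its positivity gives [|z| < 1]. *)
  have := F0 (-1 *: z); rewrite scaler_eq0 oppr_eq0 oner_eq0 => /(_ z0).
  rewrite /randers /inner_norm zP !(innerZl gP, innerZr gP) mulN1r mulN1r opprK.
  rewrite -/(inner_norm g z) -(sqr_inner_norm gP) subr_gt0 => h.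
  by rewrite exprn_ilt1// ?ltW//; rewrite expr2 gtr_pMl in h.
(* The quadratic equation says that [m q - z] has unit length. *)
have [m m0 mE] := quadratic_pos_root (g q q) (g q z) _ (g_gt0 _ q0) z1.
pose w := m *: q + (-1) *: z.
have ww : g w w = 1.
  rewrite -[RHS]mE !(innerDl gP, innerDr gP, innerZl gP, innerZr gP) (gC z q).
  by ring.
have w1 : inner_norm g w = 1 by rewrite /inner_norm ww sqrtr1.
have w0 : w != 0.
  by apply: contra_eq_neq ww => ->; rewrite (inner0l gP) eq_sym oner_neq0.
(* The differential at the unit vector [w] is [g (w + z) = m p], so the Legendre image of [a *: w]
   is [a * F w * m] times [p]; [a] makes this factor 1. *)
have Fw := F0 _ w0; pose a := (randers g b w * m)^-1.
have a0 : 0 < a by rewrite invr_gt0 mulr_gt0.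
have y0 : a *: w != 0 by rewrite scaler_eq0 negb_or gt_eqF.
exists (a *: w) => // v; rewrite (fiber_legendre_randers gP)// (randersZ gP) ?ltW//.
rewrite (randers_diffZ gP)// /randers_diff w1 divr1 zP qP.
rewrite !(innerDl gP, innerZl gP) mulN1r subrK /a.
by field; rewrite !gt_eqF.
Qed.

(** * Transfer to tangent spaces and the duality formula *)

Definition chart_coord {R : realType} {n : nat} {M : manifold R n} {x : M}
    (i : atlas_index M) (y : tangent x) : 'rV[R]_n := y i.

Lemma chart_coord_linear {R : realType} {n : nat} {M : manifold R n} {x : M}
  (i : atlas_index M) : linear (@chart_coord R n M x i).
Proof. by []. Qed.

HB.instance Definition _ (R : realType) (n : nat) (M : manifold R n) (x : M)
    (i : atlas_index M) :=
  GRing.isLinear.Build R (tangent x) 'rV[R]_n _ (@chart_coord R n M x i)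
    (chart_coord_linear i).

(** Coherence determines the other coordinates: transition differentials in charts around [x], zero
    elsewhere. This supplies the injection used for finite dimension. *)
Lemma chart_coord_inj {R : realType} {n : nat} {M : manifold R n} {x : M}
    (i : atlas_index M) :
  chart_dom (atlas i) x -> injective (@chart_coord R n M x i).
Proof.
move=> xi y z yz; apply: val_inj; apply/funext => j.
have /asboolP[y0 yP] := valP y; have /asboolP[z0 zP] := valP z.
have [xj|xj] := pselect (chart_dom (atlas j) x); last by rewrite y0// z0.
by rewrite (yP i j)// (zP i j)//; congr ('d _ _ _).
Qed.

Lemma riemannian_inner_product {R : realType} {n : nat} {M : manifold R n}
    {g : forall x : M, tangent x -> tangent x -> R} :
  riemannian_metric g -> forall x, inner_product (g x).
Proof.
move=> [gC g0 gS] x; split; [move=> a y z v|exact: gC|exact: g0].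
have [i xi] := atlas_cover x; have [A [_ gE]] := gS i.
rewrite !gE// mulr_sumr -big_split/=; apply: eq_bigr => k _.
rewrite mulr_sumr -big_split/=; apply: eq_bigr => l _.
have /= -> : tcoord (a *: y + z) i = a *: y i + z i by [].
by rewrite !mxE; ring.
Qed.

(** On the unit vector [z] along [y], the dual norm bound gives [b z > -1], so the Randers norm
    [1 + b z] is positive. *)
Lemma covector_norm_randers_gt0 {R : realType} {n : nat} {M : manifold R n}
    {g : forall x : M, tangent x -> tangent x -> R} {x : M} {b : cotangent x} :
  inner_product (g x) -> (covector_norm g b < 1)%E ->
  forall y : tangent x, y != 0 -> 0 < randers (g x) b y.
Proof.
move=> gP b1 y y0; have s0 := inner_norm_gt0 gP y y0.
pose z := (inner_norm (g x) y)^-1 *: y.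
have z1 : inner_norm (g x) z = 1.
  by rewrite (inner_normZ gP) ?invr_ge0 ?ltW// mulVf// gt_eqF.
have : (`|b z : R|%:E < 1)%E.
  apply: le_lt_trans b1; apply: ereal_sup_ubound; exists z => //=.
  by rewrite -[riemannian_norm _ _]/(inner_norm (g x) z) z1.
rewrite lte_fin ltr_norml => /andP[bz _].
have -> : y = inner_norm (g x) y *: z.
  by rewrite scalerA divff ?scale1r// gt_eqF.
by rewrite (randersZ gP) ?ltW// mulr_gt0// /randers z1; lra.
Qed.

Theorem lemma3p1 (R : realType) (n : nat) (M : manifold R n)
    (F : forall x : M, tangent x -> R)
    (g : forall x : M, tangent x -> tangent x -> R)
    (beta : forall x : M, cotangent x)
    (W : forall x : M, tangent x)
    (Ft : forall x : M, tangent x -> R)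
    (gt : forall x : M, tangent x -> tangent x -> R)
    (betat : forall x : M, cotangent x)
    (K Kt : forall x : M, cotangent x -> R) :
  randers_metric F g beta ->
  randers_positive_definite g beta ->
  smooth_vector_field W ->
  (forall x : M, F x (- W x) < 1) ->
  randers_metric Ft gt betat ->
  has_navigation_data Ft F W ->
  legendre_dual F K ->
  legendre_dual Ft Kt <->
    (forall (x : M) (p : cotangent x), Kt x p = K x p + wstar W p).
Proof.
move=> [gM _ FE] bpos _ FW [gtM _ FtE] nav KP.
have gP := riemannian_inner_product gM; have hP := riemannian_inner_product gtM.
have Fx x : F x = randers (g x) (beta x) by apply/funext => y; exact: FE.
have Ftx x : Ft x = randers (gt x) (betat x) by apply/funext => y; exact: FtE.
have F0 x := covector_norm_randers_gt0 (gP x) (bpos x).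
have Fw x : randers (g x) (beta x) (- W x) < 1 by rewrite -Fx.
have navE x y : randers (gt x) (betat x) y = 1 <->
    randers (g x) (beta x) (y - W x) = 1.
  have := congr1 (@^~ y) (nav x); rewrite /indicatrix/= Fx Ftx => ->.
  split => [[u Fu <-]|]; first by rewrite addrK.
  by move=> Fu; exists (y - W x) => //; rewrite subrK.
have [K1 K2] := KP.
(* Together with [dual0], this shows that [K + W^*] satisfies the defining equations of the dual of
   [Ft]. *)
have dualE x (p : cotangent x) y : y != 0 -> (forall v, p v = legendre Ft y v) ->
    K x p + wstar W p = Ft x y.
  move=> y0 pE; rewrite Ftx.
  have [u [u0 uE ->]] :=
    navigation_legendre (gP x) (hP x) (F0 x) (Fw x) (navE x) y y0.
  congr (_ + _).
    by rewrite -Fx; apply: K1 => // v; rewrite pE /legendre Fx Ftx; exact/esym/uE.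
  by rewrite /wstar pE /legendre Ftx.
have dual0 x (p : cotangent x) : (forall v, p v = 0) -> K x p + wstar W p = 0.
  by move=> p0; rewrite K2// /wstar p0 addr0.
split => [[Kt1 Kt2] x p|KtE].
  (* Uniqueness: these equations fix [Kt] at zero and on Legendre images, and by surjectivity every
     nonzero covector is such an image. *)
  have [p0|p0] := pselect (forall v, p v = 0); first by rewrite Kt2// dual0.
  have [i xi] := atlas_cover x.
  have Ft0 : forall y : tangent x, y != 0 -> 0 < randers (gt x) (betat x) y.
    by apply: (navigation_gt0 (gP x) (hP x) (F0 x) (Fw x)) => y /navE.
  have [y y0 yP] := fiber_legendre_surj p (hP x) (chart_coord_inj i xi) Ft0 p0.
  have pE v : p v = legendre Ft y v by rewrite yP /legendre Ftx.
  by rewrite (Kt1 x y)// (dualE x p y).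
split => [x y p y0 pE|x p p0]; first by rewrite KtE (dualE x p y).
by rewrite KtE dual0.
Qed.
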